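(* Let $S$ be a subset of the variables generating $R_{C_n}$, and let $Z_S=\{z_{i_1},\dots,z_{i_k}\}$ be the set of variables $z_i$, $i\in[n]$, contained in $S$, where $i_1<\cdots<i_k$. Then $S$ is a facet of the triangulation of $\mathcal{C}_{C_n}$ corresponding to the lexicographic order described in the context if and only if all of the following hold: (1) $Z_S\neq\emptyset$; (2) for all $t\in[k-1]$, the restriction of $S$ to the interval of vertices $i_t,i_t+1,\dots,i_{t+1}$ is admissible; (3) the restriction of $S$ to the cyclic interval of vertices $i_k,i_k+1,\dots,i_1$ (addition modulo $n$, going once around the cycle from $i_k$ to $i_1$; if $k=1$ this runs through all $n$ edges of the cycle, from $i_1$ back to $i_1$) is admissible, with $i_1$ as the right-most node.
   Context: $C_n$ is the $n$-cycle with vertex set $[n]$ and edge set $\{ii+1: i\in[n]\}$, with $i+1$ taken modulo $n$. For a graph $G=(V,E)$ with standard basis vectors $x_i,x_e$ of $\mathbb{R}^{|V|+|E|}$, the cosmological polytope is $\mathcal{C}_G=\mathrm{conv}\{x_i+x_j-x_e,\ x_i-x_j+x_e,\ -x_i+x_j+x_e: e=ij\in E\}$. $R_{C_n}$ is the polynomial ring over a field $K$ in the variables $z_i$ ($i\in[n]$) and, for each edge $e=ii+1$, the variables $z_{ii+1}=z_e$, $t_{ii+1}=t_e$, $y_{ii+1}$, $y_{i+1i}$. They correspond to the lattice points of $\mathcal{C}_{C_n}$: $z_i\leftrightarrow x_i$, $z_e\leftrightarrow x_e$, $y_{ii+1}\leftrightarrow x_i-x_{i+1}+x_e$, $y_{i+1i}\leftrightarrow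 -x_i+x_{i+1}+x_e$, $t_e\leftrightarrow x_i+x_{i+1}-x_e$. The toric ideal $I_{\mathcal{C}_{C_n}}$ is the kernel of the $K$-algebra map sending each variable to the Laurent monomial whose exponent vector is the corresponding lattice point. Consider the lexicographic term order induced by $$y_{12}>y_{23}>\cdots>y_{n-1\,n}>y_{n1}>y_{1n}>y_{n\,n-1}>\cdots>y_{21}>z_{12}>\cdots>z_{n-1\,n}>z_{n1}>t_{12}>\cdots>t_{n-1\,n}>t_{n1}>z_1>\cdots>z_n.$$ The initial ideal of $I_{\mathcal{C}_{C_n}}$ with respect to this order is squarefree and is the Stanley–Reisner ideal of a regular unimodular triangulation of $\mathcal{C}_{C_n}$: a set $S$ of variables is a face iff the product of the variables in $S$ is not in the initial ideal. Facets are the inclusion-maximal faces. Admissible restriction. For an edge $\ell\,\ell+1$ (indices mod $n$) write $S_\ell=S\cap\{y_{\ell\,\ell+1},y_{\ell+1\,\ell},z_{\ell\,\ell+1},t_{\ell\,\ell+1}\}$, $D_\ell^{\leftarrow}=\{y_{\ell+1\,\ell},z_{\ell\,\ell+1}\}$, $D_\ell^{\rightarrow}=\{y_{\ell\,\ell+1},z_{\ell\,\ell+1}\}$. Consider consecutive vertices $a,a+1,\dots,a+d$ of the cycle (indices mod $n$, $d\ge1$), with $z_a,z_{a+d}\in S$ and no $z_{a+s}\in S$ for $0<s<d$; the edges of this interval are $S_a,S_{a+1},\dots,S_{a+d-1}$ from left to right. The restriction of $S$ to this interval is admissible if one of the following holds: (i) there is exactly one $s$ with $1\le s\le d-1$ such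 that $S_{a+s}=\{t_{a+s\,a+s+1}\}$ or $S_{a+s}=\{y_{a+s+1\,a+s}\}$; moreover $S_{a+u}=D_{a+u}^{\leftarrow}$ for $s<u\le d-1$, $S_a=D_a^{\rightarrow}$, and $S_{a+u}\in\{D_{a+u}^{\leftarrow},D_{a+u}^{\rightarrow}\}$ for $0<u<s$; or (ii) $S_a=\{z_{a\,a+1}\}$ or $S_a=\{t_{a\,a+1}\}$, and $S_{a+u}=D_{a+u}^{\leftarrow}$ for all $0<u\le d-1$. *)

(* Defs.v *)
From HB Require Import structures.
From mathcomp Require Import all_boot all_order all_algebra.
From mathcomp Require Import fraction.
From mathcomp Require Export mpoly.

Set Implicit Arguments.
Unset Strict Implicit.
Unset Printing Implicit Defensive.

Import GRing.Theory.
Local Open Scope ring_scope.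

(* The n-cycle is numbered from 0: the vertices are the elements of 'I_n, and *)
(* e : 'I_n also denotes the edge joining the vertices e and ordS e, where    *)
(* ordS is the successor modulo n.                                            *)

(* With i := e and i+1 := ordS e,                                             *)
(*   yR e = y_{i i+1},  yL e = y_{i+1 i},  zE e = z_{i i+1},                  *)
(*   tE e = t_{i i+1},  zV i = z_i.                                           *)
Inductive cvar (n : nat) : predArgType :=
  | yR of 'I_n | yL of 'I_n | zE of 'I_n | tE of 'I_n | zV of 'I_n.

Arguments yR {n} _.
Arguments yL {n} _.
Arguments zE {n} _.
Arguments tE {n} _.
Arguments zV {n} _.

Definition cvar_code (n : nat) (v : cvar n) : 'I_5 * 'I_n :=
  match v with
  | yR e => (inord 0, e) | yL e => (inord 1, e) | zE e => (inord 2, e)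
  | tE e => (inord 3, e) | zV i => (inord 4, i)
  end.

Definition cvar_decode (n : nat) (p : 'I_5 * 'I_n) : cvar n :=
  match val p.1 with
  | 0%N => yR p.2 | 1%N => yL p.2 | 2%N => zE p.2
  | 3%N => tE p.2 | _ => zV p.2
  end.

Lemma cvar_codeK (n : nat) : cancel (@cvar_code n) (@cvar_decode n).
Proof. by case=> i; rewrite /cvar_decode /= inordK. Qed.

HB.instance Definition _ (n : nat) :=
  Countable.copy (cvar n) (can_type (@cvar_codeK n)).
HB.instance Definition _ (n : nat) : isFinite (cvar n) :=
  CanIsFinite (@cvar_codeK n).

Section ToricIdeal.
Variables (K : fieldType) (n : nat).

Notation ring := {mpoly K[#|{: cvar n}|]}.
Notation monom := 'X_{1..#|{: cvar n}|}.

Definition Xvar (v : cvar n) : ring := 'X_(enum_rank v).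

Definition mexp (m : monom) (v : cvar n) : nat := m (enum_rank v).

(* The standard basis of R^{|V|+|E|}: the n vertices, then the n edges. *)
Definition xv (i : 'I_n) : 'rV[int]_(n + n) := delta_mx 0 (lshift n i).
Definition xe (e : 'I_n) : 'rV[int]_(n + n) := delta_mx 0 (rshift n e).

Definition lattice_point (v : cvar n) : 'rV[int]_(n + n) :=
  match v with
  | yR e => xv e - xv (ordS e) + xe e
  | yL e => - xv e + xv (ordS e) + xe e
  | zE e => xe e
  | tE e => xv e + xv (ordS e) - xe e
  | zV i => xv i
  end.

(* The Laurent polynomial ring is taken inside the field of rational          *)
(* functions in the same n + n indeterminates.                                *)
Notation laurent := {fraction {mpoly K[n + n]}}.

Definition laurent_monomial (a : 'rV[int]_(n + n)) : laurent :=
  \prod_(j < n + n) tofrac 'X_j ^ a 0 j.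

Definition toric_map (p : ring) : laurent :=
  mmap (@tofrac _ \o @mpolyC (n + n) K)
       (fun k => laurent_monomial (lattice_point (enum_val k))) p.

Definition toric_ideal (p : ring) : Prop := toric_map p = 0.

(* The position of a variable in the decreasing list                          *)
(*   y_{12} > ... > y_{n1} > y_{1n} > y_{n n-1} > ... > y_{21} >              *)
(*   z_{12} > ... > z_{n1} > t_{12} > ... > t_{n1} > z_1 > ... > z_n.         *)
Definition vrank (v : cvar n) : nat :=
  match v with
  | yR e => e
  | yL e => (n + rev_ord e)%N
  | zE e => (2 * n + e)%N
  | tE e => (3 * n + e)%N
  | zV i => (4 * n + i)%N
  end.

Definition lex_lt (m1 m2 : monom) : Prop :=
  exists2 v : cvar n, (mexp m1 v < mexp m2 v)%N
    & forall w : cvar n, (vrank w < vrank v)%N -> mexp m1 w = mexp m2 w.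

Definition leading_monomial (p : ring) (m : monom) : Prop :=
  m \in msupp p /\ forall m', m' \in msupp p -> m' <> m -> lex_lt m' m.

Definition ideal_generated (G : ring -> Prop) (p : ring) : Prop :=
  exists2 s : seq (ring * ring),
    (forall qg, qg \in s -> G qg.2) & p = \sum_(qg <- s) qg.1 * qg.2.

Definition initial_ideal : ring -> Prop :=
  ideal_generated (fun g => exists f m,
    [/\ toric_ideal f, leading_monomial f m & g = 'X_[m]]).

Definition is_face (S : {set cvar n}) : Prop :=
  ~ initial_ideal (\prod_(v in S) Xvar v).

Definition is_facet (S : {set cvar n}) : Prop :=
  is_face S /\
  forall S' : {set cvar n}, is_face S' -> S \subset S' -> S' = S.

End ToricIdeal.

Section Admissible.
Variables (n : nat) (S : {set cvar n}).

(* Z_S, given by the indices of its elements *)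
Definition Zset : {set 'I_n} := [set j | zV j \in S].

Definition edge_part (l : 'I_n) : {set cvar n} :=
  S :&: [set yR l; yL l; zE l; tE l].

Definition Dleft (l : 'I_n) : {set cvar n} := [set yL l; zE l].
Definition Dright (l : 'I_n) : {set cvar n} := [set yR l; zE l].

(* a + u modulo n, as a vertex or as the edge starting there *)
Definition shift (a : 'I_n) (u : nat) : 'I_n := iter u (@ordS n) a.

(* The interval of length d starting at a has edges a, ..., a + d - 1; the    *)
(* value d = n is allowed and gives one full turn around the cycle.           *)
Definition admissible_i (a : 'I_n) (d : nat) : Prop :=
  let t_or_yL s := edge_part (shift a s) = [set tE (shift a s)] \/
                   edge_part (shift a s) = [set yL (shift a s)] in
  exists s : nat,
    [/\ (0 < s < d)%N /\ t_or_yL s,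
        forall s', (0 < s' < d)%N -> t_or_yL s' -> s' = s,
        forall u, (s < u < d)%N -> edge_part (shift a u) = Dleft (shift a u),
        edge_part a = Dright a
      & forall u, (0 < u < s)%N ->
          edge_part (shift a u) = Dleft (shift a u) \/
          edge_part (shift a u) = Dright (shift a u)].

Definition admissible_ii (a : 'I_n) (d : nat) : Prop :=
  (edge_part a = [set zE a] \/ edge_part a = [set tE a]) /\
  forall u, (0 < u < d)%N -> edge_part (shift a u) = Dleft (shift a u).

Definition admissible (a : 'I_n) (d : nat) : Prop :=
  [/\ (0 < d)%N, zV a \in S /\ zV (shift a d) \in S,
      forall u, (0 < u < d)%N -> zV (shift a u) \notin S
    & admissible_i a d \/ admissible_ii a d].

End Admissible.

(* Main.v *)
Require Import Defs.
From mathcomp Require Import all_boot all_order all_algebra.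
From mathcomp Require Import fraction zify ring.
From Stdlib Require Import Classical.

Set Implicit Arguments.
Unset Strict Implicit.
Unset Printing Implicit Defensive.

(** A monomial lies in the initial ideal of a toric ideal exactly when it is
    a multiple of a monomial that is not the smallest in its fiber, so faces
    can be studied through the integer relations d among the lattice points:
    S is a face iff there is no relation d that is at least -1 on S, at least
    0 off S, and whose first nonzero coordinate in the variable order is
    negative ([not_face_of_move], [face_of_no_move]).  On an n-cycle the
    relations are parametrized freely by their coordinates R, L, Z on the
    variables yR, yL, zE: writing T = R + L + Z and x = R - L on each edge,
    the coordinate of d on tE is T, and that on the vertex between the edges
    e and e + 1 is x_e - x_(e+1) - T_e - T_(e+1).

    Moves supported on one edge, or on a run of edges with T = 0 and constant
    x = 1 or x = -1, give necessary conditions for a face, collected in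
    [reduced] ([face_reduced]).  The theorem follows from three facts.

    - A set satisfying the conditions of the theorem, called [complete] below,
      is a face ([complete_face]).  A relation that is nonnegative off S has
      T >= 0 on every edge, and x is nonincreasing along each interval
      between consecutive vertices of S.  The shape of an admissible interval
      turns this into R >= 0; then into L >= 0 when R = 0; then into Z >= 0 when
      R = L = 0, so the first nonzero coordinate is never negative.

    - A reduced set that is maximal under inclusion is complete
      ([maximal_complete]).  Maximality says that every variable whose
      addition keeps the set reduced is already there; as no vertex can be
      added inside an interval, the interval has at most one edge with t and
      no yR after it, and the remaining edges are filled up to one of the
      admissible shapes.

    - No reduced set properly contains a complete one
      ([complete_antichain]).

    Hence a facet, being reduced, lies in a maximal reduced set, which is a
    complete face and so equals it; conversely a face above a complete set is
    reduced, hence equal to it. *)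

(** * Fibers of the lattice map and the initial ideal *)

Section Fibers.
Import Order.TTheory GRing.Theory Num.Theory.
Local Open Scope ring_scope.
Variables (K : fieldType) (n : nat).

Notation ring := {mpoly K[#|{: cvar n}|]}.
Notation monom := 'X_{1..#|{: cvar n}|}.

Definition weight (m : monom) : 'rV[int]_(n + n) :=
  \sum_(v : cvar n) lattice_point v *+ mexp m v.

Definition set_monom (S : {set cvar n}) : monom :=
  [multinom (enum_val k \in S : nat) | k < #|{: cvar n}|].

Lemma mexp_set_monom (S : {set cvar n}) v : mexp (set_monom S) v = (v \in S).
Proof. by rewrite /mexp mnmE enum_rankK. Qed.

Lemma prod_Xvar (S : {set cvar n}) :
  \prod_(v in S) Xvar K v = 'X_[set_monom S].
Proof.
rewrite mpolyXE_id (reindex (@enum_rank {: cvar n})) /=; last first.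
  by apply: onW_bij; exact: enum_rank_bij.
rewrite big_mkcond /=; apply: eq_bigr => v _.
by rewrite mnmE enum_rankK /Xvar; case: (v \in S).
Qed.

Lemma tofracX_neq0 (j : 'I_(n + n)) :
  tofrac ('X_j : {mpoly K[n + n]}) != 0.
Proof. by rewrite tofrac_eq0 -msupp_eq0 msuppX. Qed.

Lemma laurent_monomialD a b :
  laurent_monomial K (a + b : 'rV_(n + n)) =
    laurent_monomial K a * laurent_monomial K b.
Proof.
rewrite /laurent_monomial -big_split /=; apply: eq_bigr => j _.
by rewrite mxE expfzDr // tofracX_neq0.
Qed.

Lemma laurent_monomial0 : laurent_monomial K (0 : 'rV_(n + n)) = 1.
Proof. by rewrite /laurent_monomial big1 // => j _; rewrite mxE expr0z. Qed.

Lemma laurent_monomialMn a k :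
  laurent_monomial K (a *+ k : 'rV_(n + n)) = laurent_monomial K a ^+ k.
Proof.
elim: k => [|k IHk]; first by rewrite mulr0n laurent_monomial0.
by rewrite mulrS laurent_monomialD IHk exprS.
Qed.

Lemma toric_mapX (m : monom) :
  toric_map ('X_[m] : ring) = laurent_monomial K (weight m).
Proof.
rewrite /toric_map mmapX /mmap1 /weight (big_morph _ laurent_monomialD laurent_monomial0).
rewrite [RHS](reindex (@enum_val {: cvar n} {: cvar n})) /=; last first.
  by apply: onW_bij; exact: enum_val_bij.
by apply: eq_bigr => k _; rewrite laurent_monomialMn /mexp enum_valK.
Qed.

Lemma toric_mapE (p : ring) :
  toric_map p = \sum_(m <- msupp p) tofrac (p@_m)%:MP * laurent_monomial K (weight m).
Proof.
rewrite /toric_map /mmap; apply: eq_bigr => m _ /=.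
by rewrite -toric_mapX /toric_map mmapX.
Qed.

(** Multiplying by a large enough monomial clears the negative exponents, so that
    Laurent monomials can be compared inside the polynomial ring. *)
Lemma laurent_monomial_shift (a : 'rV[int]_(n + n)) N :
    (forall j, 0 <= a 0 j + N%:Z) ->
  laurent_monomial K a * tofrac (\prod_(j < n + n) 'X_j ^+ N) =
    tofrac 'X_[[multinom absz (a 0 j + N%:Z)%R | j < n + n]].
Proof.
move=> aN; rewrite rmorph_prod /laurent_monomial -big_split /= mpolyXE_id rmorph_prod.
apply: eq_bigr => j _; rewrite /= mnmE !rmorphXn /=.
rewrite [X in _ * X]exprnP [RHS]exprnP -expfzDr ?tofracX_neq0 //.
by congr (_ ^ _); rewrite gez0_abs.
Qed.

Lemma common_shift (s : seq 'rV[int]_(n + n)) :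
  exists N, forall a, a \in s -> forall j, 0 <= a 0 j + N%:Z.
Proof.
elim: s => [|a s [N IH]]; first by exists 0%N.
exists (N + \sum_(j < n + n) absz (a ord0 j))%N => b; rewrite inE.
case/predU1P=> [->|bs] j; last by have := IH b bs j; lia.
rewrite (bigD1 j) //=; move: (\sum_(i < _ | _) _)%N (a 0 j) => s1 x. lia.
Qed.

(** After clearing denominators, the image of f is a polynomial whose
    coefficient at the weight of m is the sum of the coefficients of f on the
    fiber of m; this sum cannot vanish with a single nonzero term. *)
Lemma toric_ideal_fiber (f : ring) m : toric_ideal f -> m \in msupp f ->
  exists m', [/\ m' \in msupp f, m' != m & weight m' = weight m].
Proof.
move=> f0 mf; have [/hasP[m' m'f /andP[nm /eqP wm]]|/hasPn none] :=
  boolP (has (fun m' => (m' != m) && (weight m' == weight m)) (msupp f)).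
  by exists m'.
have [N shiftN] := common_shift [seq weight m' | m' <- msupp f].
pose sh (a : 'rV[int]_(n + n)) := [multinom absz (a 0 j + N%:Z)%R | j < n + n] : 'X_{1..n + n}.
have /eqP : \sum_(m' <- msupp f) f@_m' *: 'X_[sh (weight m')] = 0 :> {mpoly K[n + n]}.
  apply/eqP; rewrite -tofrac_eq0 rmorph_sum /=.
  transitivity (toric_map f == 0); last by rewrite f0 eqxx.
  rewrite -[RHS](inj_eq (mulIf (_ : tofrac
      (\prod_(j < n + n) ('X_j : {mpoly K[n + n]}) ^+ N) != 0))).
    rewrite mul0r toric_mapE mulr_suml; congr (_ == _).
    apply: eq_big_seq => m1 m1f; rewrite -mulrA laurent_monomial_shift.
      by rewrite -rmorphM /= mul_mpolyC.
    by apply: shiftN; apply: map_f.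
  rewrite rmorph_prod; apply/prodf_neq0 => j _.
  by rewrite rmorphXn expf_neq0 // tofracX_neq0.
move/eqP/(congr1 (mcoeff (sh (weight m)))); rewrite mcoeff0 raddf_sum /=.
rewrite (bigD1_seq m) //= ?msupp_uniq // mcoeffZ mcoeffX eqxx mulr1.
rewrite big_seq_cond big1 ?addr0 => [/eqP|m' /andP[m'f nm]].
  by rewrite mcoeff_eq0 mf.
rewrite mcoeffZ mcoeffX; case: eqP => [e|_]; last by rewrite mulr0.
have := none _ m'f; rewrite nm /= => /eqP[].
apply/rowP=> j; have := congr1 (fun x : 'X_{1..n + n} => x j) e.
rewrite /sh !mnmE => eqabs.
move: (shiftN _ (map_f weight m'f) j) (shiftN _ (map_f weight mf) j) eqabs.
move: (weight m' 0 j) (weight m 0 j) => x y.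
by lia.
Qed.

(** The binomial X^m - X^m' is in the toric ideal and has leading monomial m. *)
Lemma initial_ideal_lt (m m' : monom) : weight m' = weight m -> lex_lt m' m ->
  initial_ideal ('X_[m] : ring).
Proof.
move=> wm lt; have nm : m' != m.
  by apply/eqP=> e; case: lt => v; rewrite e ltnn.
exists [:: (1, 'X_[m])]; last by rewrite big_seq1 mul1r.
move=> qg; rewrite inE => /eqP-> /=; exists ('X_[m] - 'X_[m']), m.
have supp x : x \in msupp ('X_[m] - 'X_[m'] : ring) = (x \in [:: m; m']).
  rewrite mcoeff_msupp mcoeffB !mcoeffX !inE ![_ == x]eq_sym.
  case: (eqVneq x m) => [->|] /=; first by rewrite [m == m']eq_sym (negPf nm) subr0 oner_eq0.
  by move=> _; rewrite sub0r oppr_eq0; case: (x == m'); rewrite ?oner_eq0 ?eqxx.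
split=> //; last first.
  split=> [|x]; rewrite supp !inE ?eqxx // => /orP[/eqP->|/eqP-> //].
  by case.
rewrite /toric_ideal /toric_map raddfB /= -!/(toric_map _).
by rewrite !toric_mapX wm subrr.
Qed.

(** A monomial in an ideal generated by monomials is a multiple of one of the
    generators, here of the leading monomial m of some f in the toric ideal;
    m' is another monomial of f in the fiber of m. *)
Lemma initial_ideal_monom (m0 : monom) : initial_ideal ('X_[m0] : ring) ->
  exists m m',
    [/\ forall v, (mexp m v <= mexp m0 v)%N, weight m' = weight m & lex_lt m' m].
Proof.
case=> s sP e.
have /hasP[[q g] qgs /= qg0] : has (fun qg : ring * ring => m0 \in msupp (qg.1 * qg.2)) s.
  apply: contraT => /hasPn none.
  have := congr1 (mcoeff m0) e; rewrite mcoeffX eqxx raddf_sum /= big_seq big1.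
    by move/eqP; rewrite oner_eq0.
  by move=> qg qgs; apply/eqP; rewrite mcoeff_eq0 none.
have [f [m [fI [mf lead] /= gE]]] := sP _ qgs; subst g.
have [m' [m'f /eqP nm wm]] := toric_ideal_fiber fI mf.
exists m, m'; split=> //; last exact: lead.
have := msuppMX q m; move/perm_mem => eqm; move: qg0; rewrite eqm.
by case/mapP=> m1 _ -> v; rewrite /mexp mnmDE leq_addr.
Qed.
End Fibers.

(** * Faces and moves *)

Section Moves.
Import Order.TTheory GRing.Theory Num.Theory.
Local Open Scope ring_scope.
Variables (K : fieldType) (n : nat).
Implicit Types (d : cvar n -> int) (S : {set cvar n}).

Lemma big_cvar (V : nmodType) (F : cvar n -> V) :
  \sum_v F v =
    \sum_e (F (yR e) + F (yL e) + F (zE e) + F (tE e) + F (zV e)).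
Proof.
rewrite (reindex (fun p : 'I_5 * 'I_n => cvar_decode p)) /=; last first.
  apply: onW_bij; exists (@cvar_code n); last exact: cvar_codeK.
  case=> k e; rewrite /cvar_decode /=.
  case: k => [[|[|[|[|[|k]]]]] lt] //=; congr pair; apply: val_inj => /=;
    by rewrite inordK.
rewrite -(pair_bigA _ (fun k e => F (cvar_decode (k, e)))) exchange_big /=.
by apply: eq_bigr => e _; rewrite !big_ord_recl big_ord0 /= addr0 !addrA.
Qed.

(** The integer relations among the lattice points (see [balancedP]), solved for
    the coordinates on the t and on the vertices. *)
Definition balanced d :=
  (forall e, d (tE e) = d (yR e) + d (yL e) + d (zE e)) /\
  (forall e, d (zV (ordS e)) =
     - (d (tE (ordS e)) + d (yR (ordS e)) - d (yL (ordS e)))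
     - (d (tE e) + d (yL e) - d (yR e))).

Definition lex_negative d :=
  exists2 v, d v < 0 & forall w, (vrank w < vrank v)%N -> d w = 0.

Definition indicator S v : int := (v \in S : nat)%:Z.

(** A move turns the monomial of S into a lexicographically smaller one with the
    same weight. *)
Definition move_from S d :=
  [/\ balanced d, forall v, - indicator S v <= d v & lex_negative d].

Lemma indicator_ge0 S v : 0 <= indicator S v.
Proof. by []. Qed.

Lemma indicator_in S v : v \in S -> indicator S v = 1.
Proof. by rewrite /indicator => ->. Qed.

Lemma indicator_notin S v : v \notin S -> indicator S v = 0.
Proof. by rewrite /indicator => /negPf->. Qed.

Definition lattice_sum d : 'rV[int]_(n + n) := \sum_v d v *: lattice_point v.

Lemma lattice_relation_edge d e0 :
  lattice_sum d 0 (rshift n e0) =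
    d (yR e0) + d (yL e0) + d (zE e0) - d (tE e0).
Proof.
rewrite /lattice_sum summxE big_cvar (bigD1 e0) //= big1 ?addr0 => [|e ne].
  by rewrite !mxE !eqxx !eq_rlshift /=; ring.
by rewrite !mxE !eqxx !eq_rlshift !eq_rshift [e0 == e]eq_sym (negPf ne) /=; ring.
Qed.

Lemma lattice_relation_vertex d e0 (i0 := ordS e0) :
  lattice_sum d 0 (lshift n i0) =
    d (zV i0) + (d (tE i0) + d (yR i0) - d (yL i0))
    + (d (tE e0) + d (yL e0) - d (yR e0)).
Proof.
rewrite /lattice_sum summxE big_cvar.
rewrite (eq_bigr (fun e =>
    (if e == i0 then d (zV i0) + (d (tE i0) + d (yR i0) - d (yL i0)) else 0)
    + (if e == e0 then d (tE e0) + d (yL e0) - d (yR e0) else 0))); last first.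
  move=> e _; rewrite !mxE !eqxx !eq_lrshift !eq_lshift ![i0 == _]eq_sym.
  rewrite (inj_eq (@ordS_inj n)).
  by case: (eqVneq e i0) => [->|_]; case: eqVneq => [->|_] /=; ring.
by rewrite big_split /= -!big_mkcond !big_pred1_eq.
Qed.

Lemma balancedP d : balanced d <-> lattice_sum d = 0.
Proof.
split=> [[de dv]|rel].
  apply/rowP=> j; rewrite [RHS]mxE; case: (split_ordP j) => [i|e] ->.
    by rewrite -(ord_predK i) lattice_relation_vertex dv; ring.
  by rewrite lattice_relation_edge de; ring.
have rel0 j : lattice_sum d 0 j = 0 by rewrite rel mxE.
split=> e.
  by have := lattice_relation_edge d e; rewrite rel0 => /esym/eqP; rewrite subr_eq0 => /eqP->.
by have := lattice_relation_vertex d e; rewrite /= rel0; lia.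
Qed.

Lemma weightB (m m' : 'X_{1..#|{: cvar n}|}) :
  weight m' - weight m = lattice_sum (fun v => (mexp m' v)%:Z - (mexp m v)%:Z).
Proof.
rewrite /weight /lattice_sum -sumrB; apply: eq_bigr => v _.
by rewrite scalerBl -!scaler_nat !natz.
Qed.

Lemma not_face_of_move S d : move_from S d -> ~ is_face K S.
Proof.
case=> bal ge [v0 lt0 eq0]; apply; rewrite prod_Xvar.
pose m' : 'X_{1..#|{: cvar n}|} :=
  [multinom absz ((enum_val k \in S)%:Z + d (enum_val k))%R | k < #|{: cvar n}|].
have m'E v : (mexp m' v)%:Z = (v \in S)%:Z + d v.
  rewrite /mexp mnmE enum_rankK; move: (ge v); rewrite /indicator.
  by move: (d v) (v \in S) => x [] /=; lia.
have dE v : (mexp m' v)%:Z - (mexp (set_monom S) v)%:Z = d v.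
  by rewrite m'E mexp_set_monom addrAC subrr add0r.
apply: (@initial_ideal_lt _ _ _ m').
  apply/eqP; rewrite -subr_eq0 weightB; apply/eqP/balancedP.
  by split=> e; rewrite !dE; [apply: (proj1 bal)|apply: (proj2 bal)].
exists v0 => [|w /eq0]; first by have := dE v0; lia.
by have := dE w; lia.
Qed.

Lemma face_of_no_move S : (forall d, ~ move_from S d) -> is_face K S.
Proof.
move=> noS; rewrite /is_face prod_Xvar => /initial_ideal_monom[m [m' [le wm lt]]].
apply: (noS (fun v => (mexp m' v)%:Z - (mexp m v)%:Z)); split.
- by apply/balancedP; rewrite -weightB wm subrr.
- move=> v; move: (le v); rewrite mexp_set_monom /indicator.
  by move: (mexp m' v) (mexp m v) (v \in S) => x y [] /=; lia.
case: lt => v ltv eqw; exists v; first lia.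
by move=> w /eqw; lia.
Qed.
End Moves.

(** * Necessary conditions on a face *)

Section Cycle.
Variable n : nat.
Implicit Types (a b e : 'I_n).

Lemma shiftD a u v : shift (shift a u) v = shift a (u + v).
Proof. by rewrite /shift addnC iterD. Qed.

Lemma shiftS a u : shift a u.+1 = ordS (shift a u).
Proof. by []. Qed.

Lemma shift_inj u : injective (fun a => shift a u).
Proof. by elim: u => [|u IHu] a b //= /ordS_inj/IHu. Qed.

Lemma val_shift a u : shift a u = (a + u) %% n :> nat.
Proof.
elim: u => [|u IHu]; first by rewrite addn0 modn_small.
by rewrite shiftS /= IHu addnS -[in LHS]addn1 modnDml addn1.
Qed.

Lemma shift_turn a : shift a n = a.
Proof. by apply: val_inj; rewrite /= val_shift modnDr modn_small. Qed.

Lemma shift_onto a b : exists2 u, u < n & b = shift a u.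
Proof.
exists ((b + n - a) %% n); first by rewrite ltn_mod; have := ltn_ord a; lia.
apply: val_inj; rewrite /= val_shift modnDmr.
have -> : a + (b + n - a) = b + n by have := ltn_ord a; lia.
by rewrite modnDr modn_small.
Qed.
End Cycle.

Section Reduced.
Variables (n : nat).
Implicit Types (S : {set cvar n}) (c e : 'I_n).

(** The run of edges with yR or zE to the right of c ends in front of the edge
    c + m at the latest, before any vertex of S is met. *)
Definition stops S c m :=
  [/\ 0 < m, forall u, 0 < u <= m -> zV (shift c u) \notin S,
      yR (shift c m) \notin S & zE (shift c m) \notin S].

(** Forbidding the pairs in the first five fields excludes the moves on one edge
    (with the help of its left vertex in the fifth); the sixth excludes turning
    all yL of the cycle into zE; the last one excludes pushing a yR to the right
    along a run of zE up to a vertex of S, or all around the cycle. *)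
Record reduced S : Prop := Reduced {
  reduced_RL : forall e, yR e \in S -> yL e \notin S;
  reduced_Rt : forall e, yR e \in S -> tE e \notin S;
  reduced_Lt : forall e, yL e \in S -> tE e \notin S;
  reduced_Zt : forall e, zE e \in S -> tE e \notin S;
  reduced_zL : forall e, zV e \in S -> yL e \notin S;
  reduced_L : exists e, yL e \notin S;
  reduced_R : forall c, yR c \in S -> exists m, stops S c m }.

End Reduced.

Section FaceReduced.
Import Order.TTheory GRing.Theory Num.Theory.
Local Open Scope ring_scope.
Variables (K : fieldType) (n : nat).
Implicit Types (S : {set cvar n}) (d : cvar n -> int) (e : 'I_n).

(** It is enough to find a negative coordinate with no positive coordinate before
    it, rather than the first nonzero one. *)
Lemma lex_negativeP d (v0 : cvar n) : d v0 < 0 ->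
  (forall w : cvar n, (vrank w < vrank v0)%N -> d w <= 0) -> lex_negative d.
Proof.
move=> lt0 le0; case: (@arg_minnP _ v0 (fun v => d v < 0) (fun v => vrank v) lt0) => v ltv minv.
exists v => // w ltw; have lew : d w <= 0.
  by apply: le0; apply: leq_trans ltw (minv _ lt0).
apply/eqP; rewrite eq_le lew leNgt; apply/negP=> /minv.
by rewrite leqNgt ltw.
Qed.

(** The relation with prescribed coordinates on the yR, yL and zE. *)
Definition edge_move (R L Z : 'I_n -> int) (v : cvar n) : int :=
  match v with
  | yR e => R e | yL e => L e | zE e => Z e | tE e => R e + L e + Z e
  | zV i => - (2 * R i + Z i) - (2 * L (ord_pred i) + Z (ord_pred i))
  end.

Lemma edge_move_balanced R L Z : balanced (edge_move R L Z).
Proof. by split=> e //=; rewrite ordSK; ring. Qed.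

Lemma vrank_yR e (w : cvar n) : (vrank w < vrank (yR e))%N -> exists e', w = yR e'.
Proof. by have := ltn_ord e; case: w => e' /=; try (by exists e'); lia. Qed.

Lemma vrank_yL e (w : cvar n) : (vrank w < vrank (yL e))%N ->
  exists e', w = yR e' \/ w = yL e'.
Proof.
have := ltn_ord e; case: w => e' /=; try (by exists e'; auto); have := ltn_ord e'; lia.
Qed.

Lemma vrank_zE e (w : cvar n) : (vrank w < vrank (zE e))%N ->
  exists e', [\/ w = yR e', w = yL e' | w = zE e'].
Proof.
have := ltn_ord e; case: w => e' /=;
  try (exists e'; by [constructor 1 | constructor 2 | constructor 3]);
  have := ltn_ord e'; lia.
Qed.

(** The moves supported on a single edge that need no vertex variable, such as
    y_(i i+1) y_(i+1 i) -> z_e^2, y_(i i+1) t_e -> z_i^2 or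
    z_e t_e -> z_i z_(i+1). *)
Lemma face_single_edge S e (a b c : int) : is_face K S ->
    2 * a + c <= 0 -> 2 * b + c <= 0 ->
    - indicator S (yR e) <= a -> - indicator S (yL e) <= b ->
    - indicator S (zE e) <= c -> - indicator S (tE e) <= a + b + c ->
  [\/ a < 0, a = 0 /\ b < 0 | [/\ a = 0, b = 0 & c < 0]] -> False.
Proof.
move=> face ac bc Ra Lb Zc Tabc neg.
pose delta (x : int) e' : int := if e' == e then x else 0.
apply: (@not_face_of_move K n S (edge_move (delta a) (delta b) (delta c))) face.
split; first exact: edge_move_balanced.
  move=> v; have := indicator_ge0 S v; case: v => e' /=;
    rewrite /delta; case: (eqVneq e' e) => [->|_] //; try lia;
    by case: (ord_pred _ == e); lia.
case: neg => [a0|[a0 b0]|[a0 b0 c0]].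
- apply: (@lex_negativeP _ (yR e)); first by rewrite /= /delta eqxx.
  by move=> w /vrank_yR[e' ->]; rewrite /= /delta; case: eqP; lia.
- apply: (@lex_negativeP _ (yL e)); first by rewrite /= /delta eqxx.
  by move=> w /vrank_yL[e' [] ->]; rewrite /= /delta; case: eqP; lia.
- apply: (@lex_negativeP _ (zE e)); first by rewrite /= /delta eqxx.
  by move=> w /vrank_zE[e' [] ->]; rewrite /= /delta; case: eqP; lia.
Qed.

(** Replacing yL by zE on all edges of P produces a vertex variable at the right
    end of each component of P and consumes one at its left end, so this is a
    move unless one of the consumed variables is absent. *)
Lemma face_left_run S (P : pred 'I_n) e0 : is_face K S -> P e0 ->
    (forall e, P e -> yL e \in S) ->
  exists e, [/\ ~~ P e, P (ordS e) & zV (ordS e) \notin S].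
Proof.
move=> face Pe0 PL.
case: (boolP [exists e, [&& ~~ P e, P (ordS e) & zV (ordS e) \notin S]]) => [|/existsPn none].
  by case/existsP=> e /and3P[]; exists e.
exfalso; pose x e : int := if P e then 1 else 0.
apply: (@not_face_of_move K n S (edge_move (fun=> 0) (fun e => - x e) x)) face.
split; first exact: edge_move_balanced.
  move=> v; have := indicator_ge0 S v; case: v => e /=; rewrite /x; try lia;
    try by case: ifP; lia.
    by case: ifP => [/PL L|_]; [rewrite (indicator_in L)|]; lia.
  have := none (ord_pred e); rewrite ord_predK.
  case: (P e); case: (P (ord_pred e)) => //=; try lia.
  by rewrite negbK => z; rewrite (indicator_in z); lia.
apply: (@lex_negativeP _ (yL e0)); first by rewrite /= /x Pe0.
by move=> w /vrank_yL[e' [] ->]; rewrite /= /x //; case: (P e').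
Qed.

(** On the edges of P replace yR by zE where possible, and zE by yL elsewhere:
    this produces a vertex variable at the left end of each component of P and
    consumes one at its right end.  Since some yR disappears and none appears,
    it is a move as soon as the consumed variables are present. *)
Lemma face_right_run S (P : pred 'I_n) e0 : is_face K S -> P e0 -> yR e0 \in S ->
    (forall e, P e -> yR e \in S \/ zE e \in S) ->
  exists e, [/\ P e, ~~ P (ordS e) & zV (ordS e) \notin S].
Proof.
move=> face Pe0 R0 PRZ.
case: (boolP [exists e, [&& P e, ~~ P (ordS e) & zV (ordS e) \notin S]]) => [|/existsPn none].
  by case/existsP=> e /and3P[]; exists e.
exfalso.
pose R e : int := if P e && (yR e \in S) then -1 else 0.
pose L e : int := if P e && (yR e \notin S) then 1 else 0.
apply: (@not_face_of_move K n S (edge_move R L (fun e => - R e - L e))) face.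
split; first exact: edge_move_balanced.
  move=> v; have := indicator_ge0 S v; case: v => e /=; rewrite /R /L; last first.
  - have := none (ord_pred e); rewrite ord_predK.
    case: (boolP (zV e \in S)) => z; rewrite ?(indicator_in z) ?(indicator_notin z);
      case: (P e); case: (P (ord_pred e)); case: (yR e \in S);
      case: (yR (ord_pred e) \in S) => //=; lia.
  - by case: (P e); case: (yR e \in S) => //=; lia.
  - have := PRZ e; case: (P e) => //=; have [|_] := boolP (yR e \in S) => //= [|H]; try lia.
    by case: H => // Z; rewrite (indicator_in Z); lia.
  - by case: (P e); case: (yR e \in S) => //=; lia.
  - case: (boolP (yR e \in S)) => [R0e|_]; rewrite ?(indicator_in R0e); by case: (P e) => /=; lia.
apply: (@lex_negativeP _ (yR e0)); first by rewrite /= /R Pe0 R0.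
by move=> w /vrank_yR[e' ->]; rewrite /= /R; case: ifP.
Qed.

(** For the last field, the run is the set of edges reached from c by following
    edges with yR or zE across vertices outside S: the run cannot close up or
    end at a vertex of S, so it ends in front of an edge with neither. *)
Lemma face_reduced S : (0 < n)%N -> is_face K S -> reduced S.
Proof.
move=> n0 face; have ge0 v x : 0 <= x -> - indicator S v <= x :> int.
  by move=> x0; apply: le_trans x0; rewrite oppr_le0 indicator_ge0.
split.
- move=> e R; apply/negP=> L.
  by apply: (@face_single_edge S e (-1) (-1) 2 face);
    rewrite ?(indicator_in R) ?(indicator_in L) //; first [exact: ge0 | apply: Or31].
- move=> e R; apply/negP=> t.
  by apply: (@face_single_edge S e (-1) 0 0 face);
    rewrite ?(indicator_in R) ?(indicator_in t) //; first [exact: ge0 | apply: Or31].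
- move=> e L; apply/negP=> t.
  by apply: (@face_single_edge S e 0 (-1) 0 face);
    rewrite ?(indicator_in L) ?(indicator_in t) //; first [exact: ge0 | apply: Or32].
- move=> e Z; apply/negP=> t.
  by apply: (@face_single_edge S e 0 0 (-1) face);
    rewrite ?(indicator_in Z) ?(indicator_in t) //; first [exact: ge0 | apply: Or33].
- move=> e z; apply/negP=> L.
  have [|e' [ne /eqP eq]] := @face_left_run S (pred1 e) e face (eqxx e).
    by move=> e' /eqP->.
  by rewrite eq z.
- have [/existsP[e]|/existsPn allL] := boolP [exists e, yL e \notin S]; first by exists e.
  have [|e []//] := @face_left_run S predT (Ordinal n0) face isT.
  by move=> e _; have := allL e; rewrite negbK.
move=> c Rc.
(* Edges of the run are linked when the right one extends it. *)
pose r x y := [&& y == ordS x, (yR y \in S) || (zE y \in S) & zV y \notin S].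
have run e : connect r c e ->
    exists m, e = shift c m /\ forall u, (0 < u <= m)%N -> zV (shift c u) \notin S.
  case/connectP=> p; elim/last_ind: p e => [|p y IHp] e /=.
    by move=> _ ->; exists 0%N; split=> // u; lia.
  rewrite rcons_path last_rcons => /andP[/IHp/(_ erefl)[m [-> noz]] /and3P[/eqP yE _ zy]] ->.
  exists m.+1; split=> // u /andP[u0]; rewrite leq_eqVlt => /orP[/eqP->|um].
    by rewrite shiftS -yE.
  by apply: noz; rewrite u0.
have [|e [ce /negP nce nz]] := @face_right_run S (connect r c) c face (connect0 r c) Rc.
  move=> e /connectP[p]; elim/last_ind: p => [|p y _] /=; first by move=> _ ->; left.
  by rewrite rcons_path last_rcons => /andP[_ /and3P[_ /orP RZ _]] ->.
have [m [eE noz]] := run e ce.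
have : ~~ r e (ordS e).
  by apply/negP=> re; apply: nce; apply: connect_trans ce (connect1 re).
rewrite /r eqxx nz andbT /= negb_or => /andP[nR nZ].
exists m.+1; split=> //; rewrite ?shiftS -?eE // => u /andP[u0].
rewrite leq_eqVlt => /orP[/eqP->|um].
  by rewrite shiftS -eE.
by apply: noz; rewrite u0.
Qed.
End FaceReduced.

(** * Admissible intervals and the faces they give *)

Section Gaps.
Variable n : nat.
Implicit Types (S : {set cvar n}) (a c e : 'I_n).

(** The canonical equality test goes through an encoding of the variables and
    does not reduce on constructors; this one does. *)
Definition cvar_eqb (v w : cvar n) : bool :=
  match v, w with
  | yR a, yR b | yL a, yL b | zE a, zE b | tE a, tE b | zV a, zV b => a == b
  | _, _ => false
  end.

Lemma cvar_eqE (v w : cvar n) : (v == w) = cvar_eqb v w.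
Proof.
by apply/eqP/idP=> [->|]; case: w => b /=; rewrite ?eqxx //; case: v => a //= /eqP->.
Qed.

Definition edge_type S e (r l z t : bool) :=
  [/\ (yR e \in S) = r, (yL e \in S) = l, (zE e \in S) = z & (tE e \in S) = t].

Lemma edge_partP S e (A : {set cvar n}) : A \subset [set yR e; yL e; zE e; tE e] ->
  edge_part S e = A <-> edge_type S e (yR e \in A) (yL e \in A) (zE e \in A) (tE e \in A).
Proof.
move=> subA; rewrite /edge_part; split=> [<-|[R L Z T]].
  by split; rewrite !inE eqxx ?orbT andbT.
apply/setP=> v; rewrite inE; case: (boolP (v \in [set yR e; _; _; _])) => [|vE].
  by rewrite andbT !inE -!orbA => /or4P[] /eqP->.
rewrite andbF; apply/esym/negbTE; apply: contra vE; exact: (subsetP subA).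
Qed.

Lemma edge_part_left S e :
  edge_part S e = Dleft e <->
    edge_type S e false true true false.
Proof.
rewrite edge_partP /Dleft ?inE ?cvar_eqE /= ?eqxx //.
by apply/subsetP=> v; rewrite !inE => /orP[]->; rewrite ?orbT.
Qed.

Lemma edge_part_right S e :
  edge_part S e = Dright e <->
    edge_type S e true false true false.
Proof.
rewrite edge_partP /Dright ?inE ?cvar_eqE /= ?eqxx //.
by apply/subsetP=> v; rewrite !inE => /orP[]->; rewrite ?orbT.
Qed.

Lemma edge_part_t S e :
  edge_part S e = [set tE e] <->
    edge_type S e false false false true.
Proof.
rewrite edge_partP ?inE ?cvar_eqE /= ?eqxx //.
by apply/subsetP=> v; rewrite !inE => ->; rewrite ?orbT.
Qed.

Lemma edge_part_yL S e :
  edge_part S e = [set yL e] <->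
    edge_type S e false true false false.
Proof.
rewrite edge_partP ?inE ?cvar_eqE /= ?eqxx //.
by apply/subsetP=> v; rewrite !inE => ->; rewrite ?orbT.
Qed.

Lemma edge_part_zE S e :
  edge_part S e = [set zE e] <->
    edge_type S e false false true false.
Proof.
rewrite edge_partP ?inE ?cvar_eqE /= ?eqxx //.
by apply/subsetP=> v; rewrite !inE => ->; rewrite ?orbT.
Qed.

Record gap S a d : Prop := Gap {
  gap_gt0 : 0 < d;
  gap_start : zV a \in S;
  gap_end : zV (shift a d) \in S;
  gap_inside : forall u, 0 < u < d -> zV (shift a u) \notin S }.

Definition edge_left S e := edge_type S e false true true false.
Definition edge_right S e := edge_type S e true false true false.

(** The two shapes of an admissible interval, read off as memberships; in the
    first shape the edge s is the place where the two orientations meet. *)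
Definition turning_gap S a d s :=
  [/\ 0 < s < d,
      edge_type S (shift a s) false false false true \/
        edge_type S (shift a s) false true false false,
      forall u, s < u < d -> edge_left S (shift a u),
      edge_right S a
    & forall u, 0 < u < s -> edge_left S (shift a u) \/ edge_right S (shift a u)].

Definition left_gap S a d :=
  (edge_type S a false false true false \/ edge_type S a false false false true) /\
  forall u, 0 < u < d -> edge_left S (shift a u).

(** Uniqueness of the turning edge in the first shape is automatic: all other
    edges of the interval carry zE, which a turning edge does not. *)
Lemma admissibleP S a d : admissible S a d <->
  gap S a d /\ ((exists s, turning_gap S a d s) \/ left_gap S a d).
Proof.
split=> [[d0 [za zd] inside adm]|[[d0 za zd inside] adm]].
  split; first by split.
  case: adm => [[s [[sd ts] _ after start before]]|[start after]]; [left; exists s|right].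
    split=> //.
    - by case: ts => [/edge_part_t|/edge_part_yL]; auto.
    - by move=> u /after/edge_part_left.
    - exact/edge_part_right.
    - by move=> u /before[/edge_part_left|/edge_part_right]; auto.
  split; first by case: start => [/edge_part_zE|/edge_part_t]; auto.
  by move=> u /after/edge_part_left.
split=> //; case: adm => [[s [sd ts after start before]]|[start after]]; [left; exists s|right].
  split.
  - by split=> //; case: ts => [/edge_part_t|/edge_part_yL]; auto.
  - move=> u ud tu; case: (ltngtP u s) => // us; exfalso.
      have {tu} : zE (shift a u) \notin S.
        by case: tu => [/edge_part_t|/edge_part_yL] [_ _ ->].
      by have [|[_ _ ->]|[_ _ ->]] := before u; first lia.
    have {tu} : zE (shift a u) \notin S.
      by case: tu => [/edge_part_t|/edge_part_yL] [_ _ ->].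
    by have [|_ _ ->] := after u; first lia.
  - by move=> u /after/edge_part_left.
  - exact/edge_part_right.
  - by move=> u /before[/edge_part_left|/edge_part_right]; auto.
split; first by case: start => [/edge_part_zE|/edge_part_t]; auto.
by move=> u /after/edge_part_left.
Qed.

(** The conditions of the theorem, freed from the enumeration of the vertices: an
    admissible interval starting at a necessarily ends at the next vertex of S,
    so its length need not be named. *)
Definition complete S :=
  (exists a, zV a \in S) /\ forall a, zV a \in S -> exists d, admissible S a d.

Lemma gap_exists S a : zV a \in S -> exists d, gap S a d.
Proof.
move=> za; have n0 : 0 < n by have := ltn_ord a; lia.
have ex : exists d, (0 < d) && (zV (shift a d) \in S).
  by exists n; rewrite n0 shift_turn.
case: (ex_minnP ex) => d /andP[d0 zd] mind; exists d; split=> // u /andP[u0 ud].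
by apply/negP=> zu; have := mind u; rewrite u0 zu => /(_ isT); lia.
Qed.

Lemma gap_uniq S a d d' : gap S a d -> gap S a d' -> d = d'.
Proof.
move=> [d0 _ zd inside] [d0' _ zd' inside']; case: (ltngtP d d') => // lt.
  by move: zd; rewrite (negPf (inside' d _)) ?d0.
by move: zd'; rewrite (negPf (inside d' _)) ?d0'.
Qed.

Lemma gap_cover S e : (exists a, zV a \in S) ->
  exists a d u, [/\ gap S a d, u < d & e = shift a u].
Proof.
case=> z zS; have [u0 _ eu0] := shift_onto z e.
have ex : exists u, [exists a, (zV a \in S) && (e == shift a u)].
  by exists u0; apply/existsP; exists z; rewrite zS eu0 eqxx.
case: (ex_minnP ex) => u /existsP[a /andP[za /eqP eu]] minu.
have [d ad] := gap_exists za; exists a, d, u; split=> //.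
rewrite ltnNge; apply/negP=> du; have := minu (u - d).
have -> : [exists a, (zV a \in S) && (e == shift a (u - d))].
  apply/existsP; exists (shift a d); rewrite (gap_end ad) shiftD.
  by rewrite subnKC // eu eqxx.
by move=> /(_ isT); have := gap_gt0 ad; lia.
Qed.

(** If no vertex of S is met on the way from c to an edge of the interval at a,
    then c is an edge of that same interval. *)
Lemma gap_position S a u c m : zV a \in S -> shift a u = shift c m ->
    (forall v, 0 < v <= m -> zV (shift c v) \notin S) ->
  m <= u /\ c = shift a (u - m).
Proof.
move=> za e noz; case: (leqP m u) => [mu|um].
  split=> //; apply: (@shift_inj n m).
  by rewrite -e shiftD subnK.
have ae : a = shift c (m - u) by apply: (@shift_inj n u); rewrite e shiftD subnK // ltnW.
by have := noz (m - u); rewrite -ae za => /(_ _)/negP[] //; lia.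
Qed.

Lemma gap_neq S a d u v : gap S a d -> u < v < d -> shift a u <> shift a v.
Proof.
move=> ad uv e; have ae : a = shift a (v - u).
  by apply: (@shift_inj n u); rewrite e shiftD subnK //; lia.
have := gap_inside ad (u := v - u); rewrite -ae (gap_start ad).
by move=> /(_ _)/negP[] //; lia.
Qed.

End Gaps.

Section CompleteFace.
Import Order.TTheory GRing.Theory Num.Theory.
Local Open Scope ring_scope.
Variables (K : fieldType) (n : nat).
Implicit Types (S : {set cvar n}) (d : cvar n -> int) (e : 'I_n).

(** With x = r - l, the condition at an inner vertex reads
    x_(u+1) <= x_u - t_u - t_(u+1), and all t_u are nonnegative.  For a turning
    interval, x_s >= - t_s at the turning edge, whence x_u >= t_u >= 0 to its
    left; as each edge there lacks yR or yL, this forces r_u >= 0.  Elsewhere,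
    and on intervals of the second shape, r_u >= 0 because yR is absent.
    When r = 0, x starts at - l_0 <= 0 and never increases, hence l = - x >= 0.
    When also l = 0, z = t >= 0. *)
Lemma gap_lex_nonneg S a len d : admissible S a len -> balanced d ->
    (forall v, v \notin S -> 0 <= d v) ->
  [/\ forall u, (u < len)%N -> 0 <= d (yR (shift a u)),
      (forall e, d (yR e) = 0) -> forall u, (u < len)%N -> 0 <= d (yL (shift a u))
    & (forall e, d (yR e) = 0 /\ d (yL e) = 0) ->
      forall u, (u < len)%N -> 0 <= d (zE (shift a u))].
Proof.
move=> /admissibleP[alen adm] [balE balV] ge0.
pose r u := d (yR (shift a u)); pose l u := d (yL (shift a u)).
pose z u := d (zE (shift a u)); pose t u := d (tE (shift a u)).
have tE_ u : t u = r u + l u + z u by apply: balE.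
have R0 u : (yR (shift a u) \in S) = false -> 0 <= r u by move/negbT/ge0.
have L0 u : (yL (shift a u) \in S) = false -> 0 <= l u by move/negbT/ge0.
have Z0 u : (zE (shift a u) \in S) = false -> 0 <= z u by move/negbT/ge0.
have T0 u : (tE (shift a u) \in S) = false -> 0 <= t u by move/negbT/ge0.
have decr u : (u.+1 < len)%N -> r u.+1 - l u.+1 <= r u - l u - t u - t u.+1.
  move=> ulen; have := ge0 _ (gap_inside alen (u := u.+1) _).
  by rewrite ulen shiftS balV -shiftS -!/(r _) -!/(l _) -!/(t _) => /(_ isT); lia.
have t_ge0 u : (u < len)%N -> 0 <= t u.
  have tt : edge_type S (shift a u) false false false true -> 0 <= t u.
    by case=> /R0 + /L0 + /Z0; rewrite tE_; lia.
  case: adm => [[s [_ ts after start before]]|[start after]].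
    case: (ltngtP u s) => [us _|su ul|us _]; last by subst u; case: ts => [/tt //|[_ _ _ /T0]].
      case: u us tt => [|u] us _; first by case: start => _ _ _ /(T0 0%N).
      by case: (before u.+1 us) => -[_ _ _ /T0].
    by have [|_ _ _ /T0] := after u; first by rewrite su.
  case: u tt => [|u] tt ul; last by have [_ _ _ /T0] := after u.+1 ul.
  by case: start => [[_ _ _ /(T0 0%N)]|/tt].
have l0 : 0 <= l 0%N.
  by apply: (L0 0%N); case: adm => [[s [_ _ _ [_ -> _ _] _]]|[[] [_ -> _ _] _]].
split=> [u ul|rz u ul|rlz u ul].
- case: adm => [[s [sd ts after start before]]|[start after]]; last first.
    case: u ul => [|u] ul; first by case: start => -[/(R0 0%N)].
    by have [/R0] := after u.+1 ul.
  have xs : - t s <= r s - l s.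
    by case: ts => -[/R0 rs0 ls /Z0 zs0 _]; rewrite tE_; [have := L0 _ ls|]; lia.
  (* Downward induction from the turning edge, with u = s - k. *)
have xu k : (0 < k <= s)%N -> t (s - k)%N <= r (s - k)%N - l (s - k)%N.
    elim: k => // k IHk ks; have := decr (s - k.+1)%N.
    have -> : (s - k.+1).+1 = (s - k)%N by lia.
    have := t_ge0 (s - k)%N.
    case: k IHk ks => [|k] IHk ks; first by rewrite subn0; lia.
    by have := IHk; lia.
  case: (ltngtP u s) => [us|su|->]; last by case: ts => -[/R0].
    have := xu (s - u)%N; have := t_ge0 u ul; have -> : (s - (s - u) = u)%N by lia.
    have lr : 0 <= r u \/ 0 <= l u.
      case: (u) us => [|u'] us; first by right.
      by case: (before u'.+1 us) => -[h1 h2 _ _]; [left; apply: R0|right; apply: L0].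
    by rewrite -/(r u); lia.
  by have [|/R0] := after u; first by rewrite su.
- have : r u - l u <= 0; last by rewrite /r rz -/(l u); lia.
  elim: u ul => [|u IHu] ul; first by rewrite /r rz; lia.
  by have := decr u ul; have := IHu (ltnW ul); have := t_ge0 u (ltnW ul); have := t_ge0 _ ul; lia.
have [r0 l0'] := rlz (shift a u); have := t_ge0 u ul.
by rewrite tE_ /r /l r0 l0' -/(z u); lia.
Qed.

(** Every edge lies in an interval, and the three blocks of variables yR,
    yL, zE come in this order, so that nonnegativity may be checked interval by
    interval; a relation vanishing on the three blocks is zero. *)
Lemma complete_face S : complete S -> is_face K S.
Proof.
case=> exz adm; apply: face_of_no_move => d [bal ge_ind [v lt0 eq0]].
have ge0 w : w \notin S -> 0 <= d w.
  by move=> wS; have := ge_ind w; rewrite (indicator_notin wS); lia.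
have gaps e : exists a len u, [/\ admissible S a len, (u < len)%N & e = shift a u].
  have [a [len [u [alen ul ->]]]] := gap_cover e exz.
  have [len' al'] := adm a (gap_start alen); exists a, len, u; split=> //.
  by have /admissibleP[/(gap_uniq alen)->] := al'.
case: v lt0 eq0 => e lt0 eq0.
- have [a [len [u [/gap_lex_nonneg/(_ bal ge0)[A _ _] ul eu]]]] := gaps e.
  by have := A u ul; rewrite -eu; lia.
- have R e' : d (yR e') = 0 by apply: eq0 => /=; have := ltn_ord e'; lia.
  have [a [len [u [/gap_lex_nonneg/(_ bal ge0)[_ B _] ul eu]]]] := gaps e.
  by have := B R u ul; rewrite -eu; lia.
- have RL e' : d (yR e') = 0 /\ d (yL e') = 0.
    by split; apply: eq0 => /=; have := ltn_ord e'; lia.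
  have [a [len [u [/gap_lex_nonneg/(_ bal ge0)[_ _ C] ul eu]]]] := gaps e.
  by have := C RL u ul; rewrite -eu; lia.
all: have RLZ e' : [/\ d (yR e') = 0, d (yL e') = 0 & d (zE e') = 0]
  by split; apply: eq0 => /=; have := ltn_ord e'; have := ltn_ord e; lia.
  by case: bal => /(_ e) balE _; have [] := RLZ e; lia.
case: bal => balE /(_ (ord_pred e)); rewrite ord_predK !balE.
by have [] := RLZ e; have [] := RLZ (ord_pred e); lia.
Qed.
End CompleteFace.

(** * Maximal reduced sets *)

Section Maximal.
Variable n : nat.
Implicit Types (S : {set cvar n}) (a c e r : 'I_n).

(** On each edge of S an extra variable meets one of the forbidden pairs, except
    for zE on a turning edge and yR on a first edge carrying only zE; these two,
    as well as an extra vertex left of a turning edge, let the yR at the start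
    of the interval run into a vertex.  An extra vertex elsewhere meets a yL. *)
Lemma complete_antichain S S' : complete S -> S \subset S' -> reduced S' -> S' = S.
Proof.
case=> exz adm /subsetP SS' red; apply/setP=> v; apply/idP/idP; last exact: SS'.
have [RL Rt Lt Zt zL _ Rstop] := red.
have pos e : exists a len u,
    [/\ gap S a len, (exists s, turning_gap S a len s) \/ left_gap S a len,
        u < len & e = shift a u].
  have [a [len [u [alen ul ->]]]] := gap_cover e exz.
  have [len' /admissibleP[/(gap_uniq alen)<- al]] := adm a (gap_start alen).
  by exists a, len, u; split.
have stop_before a k : zV (shift a k) \in S' -> 0 < k -> yR a \in S' ->
    (forall m, 0 < m < k -> zE (shift a m) \in S') -> False.
  move=> zk k0 /Rstop[m [m0 noz _ nZ]] Zs.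
  case: (leqP k m) => [km|mk]; first by move: zk; apply/negP/noz; rewrite k0.
  by move: nZ; rewrite Zs // m0.
have left_in e w : edge_left S e -> w \in [:: yR e; tE e] -> w \in S' -> False.
  case=> _ L _ _; rewrite !inE => /orP[]/eqP-> H.
    by move: (RL _ H); rewrite SS'.
  by move: (Lt e); rewrite H SS' // => /(_ isT).
have right_in e w : edge_right S e -> w \in [:: yL e; tE e] -> w \in S' -> False.
  case=> R _ _ _; rewrite !inE => /orP[]/eqP-> H.
    by move: (RL e); rewrite H SS' // => /(_ isT).
  by move: (Rt e); rewrite H SS' // => /(_ isT).
have t_in e w : tE e \in S -> w \in [:: yR e; yL e; zE e] -> w \in S' -> False.
  move=> /SS' t; rewrite !inE => /or3P[]/eqP-> H.
  - by move: (Rt e H); rewrite t.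
  - by move: (Lt e H); rewrite t.
  - by move: (Zt e H); rewrite t.
have edge_case e w : w \in [:: yR e; yL e; zE e; tE e] -> w \in S' -> w \in S.
  move=> we wS'; have [a [len [u [alen adma ul eu]]]] := pos e.
  have left : edge_left S e -> w \in S.
    move=> te; move: we; rewrite !inE => /or4P[] /eqP we; rewrite we // in wS' *;
      by [case: te | case: (left_in e _ te _ wS'); rewrite !inE eqxx ?orbT].
  have right : edge_right S e -> w \in S.
    move=> te; move: we; rewrite !inE => /or4P[] /eqP we; rewrite we // in wS' *;
      by [case: te | case: (right_in e _ te _ wS'); rewrite !inE eqxx ?orbT].
  have t : tE e \in S -> w \in S.
    move=> te; move: we; rewrite !inE => /or4P[] /eqP we; rewrite we // in wS' *;
      by [case: te | case: (t_in e _ te _ wS'); rewrite !inE eqxx ?orbT].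
  have zend := SS' _ (gap_end alen); have len0 := gap_gt0 alen.
  case: adma => [[s [sd ts after start before]]|[start after]].
    case: (ltngtP u s) => [us|su|us].
    - case: (posnP u) => u0; first by apply: right; rewrite eu u0.
      by rewrite eu in left right; case: (before u); rewrite ?u0.
    - by apply: left; rewrite eu; apply: after; rewrite su.
    subst u; rewrite -eu in ts; case: ts => [[_ _ _ te]|[nR L nZ nt]]; first exact: t.
    move: we; rewrite !inE => /or4P[] /eqP we; rewrite we // in wS' *.
    - by move: (RL _ wS'); rewrite SS'.
    - exfalso; apply: (stop_before a len zend len0).
        by case: start => /SS'.
      move=> m /andP[m0 ml]; case: (ltngtP m s) => [ms|sm|->]; last by rewrite -eu.
        by apply: SS'; case: (before m); rewrite ?m0 // => -[].
      by apply: SS'; case: (after m); rewrite ?sm.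
    - by move: (Lt e); rewrite wS' SS' // => /(_ isT).
  case: (posnP u) => u0; last by apply: left; rewrite eu; apply: after; rewrite u0.
  subst u; rewrite /= in eu; subst e.
  case: start => [[nR nL Z nt]|[_ _ _ te]]; last exact: t.
  move: we; rewrite !inE => /or4P[] /eqP we; rewrite we // in wS' *.
  - exfalso; apply: (stop_before a len zend len0) => // m /after[_ _ Zm _].
    exact: SS'.
  - by move: (zL a (SS' _ (gap_start alen))); rewrite wS'.
  - by move: (Zt a); rewrite wS' SS' // => /(_ isT).
case: v => e; try by apply: (edge_case e); rewrite !inE eqxx ?orbT.
move=> ze; have [a [len [u [alen adma ul eu]]]] := pos e.
case: (posnP u) => u0; first by rewrite eu u0 (gap_start alen).
exfalso; have left : edge_left S (shift a u) -> False.
  by rewrite -eu => -[_ L _ _]; move: (zL e ze); rewrite SS'.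
case: adma => [[s [sd ts after start before]]|[start after]]; last first.
  by apply/left/after; rewrite u0.
case: (ltnP s u) => [su|us]; first by apply/left/after; rewrite su.
apply: (stop_before a u); rewrite -?eu //; first by case: start => /SS'.
move=> m /andP[m0 mu]; apply: SS'.
by case: (before m) => [|[]|[]] //; rewrite m0; apply: leq_trans us.
Qed.

(** Besides meeting a yL, a new vertex r is harmful only when it separates a run
    from its stopping edge, so it suffices that each yR whose run would reach r
    be stopped strictly before. *)
Lemma add_zV S r : reduced S -> yL r \notin S ->
    (forall c u, yR c \in S -> 0 < u -> r = shift c u ->
       (forall v, 0 < v < u -> zV (shift c v) \notin S) ->
     exists m, [/\ 0 < m < u, yR (shift c m) \notin S & zE (shift c m) \notin S]) ->
  reduced (zV r |: S).
Proof.
case=> RL Rt Lt Zt zL L Rs nL H; split=> [e|e|e|e|e||c]; rewrite ?inE ?cvar_eqE /=.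
- exact: RL.
- exact: Rt.
- exact: Lt.
- exact: Zt.
- by case/orP=> [/eqP->//|/zL].
- by case: L => e eL; exists e; rewrite !inE cvar_eqE.
move=> Rc; have [m0 [m00 noz nR nZ]] := Rs c Rc.
have [/existsP ex|/existsPn none] := boolP [exists u : 'I_m0.+1, (0 < u) && (r == shift c u)].
  have ex' : exists u, (0 < u) && ((u <= m0) && (r == shift c u)).
    by case: ex => u /andP[u0 ru]; exists u; rewrite u0 ru andbT -ltnS /=.
  case: (ex_minnP ex') => u /and3P[u0 um /eqP ru] minu.
  have [|m [/andP[m_0 mu] mR mZ]] := H c u Rc u0 ru.
    by move=> v /andP[v0 vu]; apply: noz; rewrite v0; lia.
  exists m; split; rewrite ?inE ?cvar_eqE //= => v /andP[v0 vm].
  rewrite !inE cvar_eqE /= negb_or noz ?andbT; last by rewrite v0; lia.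
  by apply/eqP=> e; have := minu v; rewrite v0 e eqxx; lia.
exists m0; split; rewrite ?inE ?cvar_eqE //= => v /andP[v0 vm].
rewrite !inE cvar_eqE /= negb_or noz ?v0 ?vm ?andbT // eq_sym.
by have := none (Ordinal (vm : v < m0.+1)); rewrite /= v0.
Qed.

(** Every run can be stopped at an edge other than e, so all runs remain stopped
    when zE or yR is put on e. *)
Definition reroute S e :=
  forall c, yR c \in S -> exists2 m, stops S c m & shift c m != e.

Lemma add_zE S e : reduced S -> tE e \notin S -> reroute S e -> reduced (zE e |: S).
Proof.
case=> RL Rt Lt Zt zL L Rs nt H; split=> [f|f|f|f|f||c]; rewrite ?inE ?cvar_eqE /=.
- exact: RL.
- exact: Rt.
- exact: Lt.
- by case/orP=> [/eqP->//|/Zt].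
- exact: zL.
- by case: L => f fL; exists f; rewrite !inE cvar_eqE.
move=> /H[m [m0 noz nR nZ] ne]; exists m.
by split; rewrite ?inE ?cvar_eqE //= ?negb_or ?ne // => v /noz; rewrite !inE cvar_eqE.
Qed.

Lemma add_yR S e : reduced S -> yL e \notin S -> tE e \notin S ->
    reroute S e -> (exists2 m, stops S e m & shift e m != e) ->
  reduced (yR e |: S).
Proof.
case=> RL Rt Lt Zt zL L Rs nL nt H He; split=> [f|f|f|f|f||c]; rewrite ?inE ?cvar_eqE /=.
- by case/orP=> [/eqP->//|/RL].
- by case/orP=> [/eqP->//|/Rt].
- exact: Lt.
- exact: Zt.
- exact: zL.
- by case: L => f fL; exists f; rewrite !inE cvar_eqE.
move=> Rc; have [m [m0 noz nR nZ] ne] : exists2 m, stops S c m & shift c m != e.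
  by case/orP: Rc => [/eqP->|/H].
exists m.
by split; rewrite ?inE ?cvar_eqE //= ?negb_or ?ne // => v /noz; rewrite !inE cvar_eqE.
Qed.

Lemma add_yL S e : reduced S -> yR e \notin S -> tE e \notin S -> zV e \notin S ->
  (exists2 e', yL e' \notin S & e' != e) -> reduced (yL e |: S).
Proof.
case=> RL Rt Lt Zt zL L Rs nR nt nz [e' e'L ne]; split=> [f|f|f|f|f||c]; rewrite ?inE ?cvar_eqE /=.
- move=> fR; rewrite negb_or RL // andbT.
  by apply: contraNneq nR => <-.
- exact: Rt.
- by case/orP=> [/eqP->//|/Lt].
- exact: Zt.
- move=> fz; rewrite negb_or zL // andbT.
  by apply: contraNneq nz => <-.
- by exists e'; rewrite !inE cvar_eqE /= negb_or ne.
move=> /Rs[m [m0 noz mR mZ]]; exists m.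
by split; rewrite ?inE ?cvar_eqE //= => v /noz; rewrite !inE cvar_eqE.
Qed.

Definition maximal_reduced S :=
  reduced S /\ forall v, reduced (v |: S) -> v \in S.

(** Without vertices, one may be added at the first yR behind an edge that stops
    some run, or, in the absence of yR, at any edge without yL. *)
Lemma maximal_has_vertex S : maximal_reduced S -> exists a, zV a \in S.
Proof.
case=> red maxS; have [RL _ _ _ _ [r0 nL] Rs] := red.
have [/existsP[c0 Rc0]|/existsPn noR] := boolP [exists c, yR c \in S]; last first.
  exists r0; apply/maxS/add_zV => // c u; by rewrite (negPf (noR c)).
have [m0 [_ _ nR nZ]] := Rs c0 Rc0; set b := shift c0 m0 in nR nZ.
have ex : exists m, (0 < m) && (yR (shift b m) \in S).
  have [u _ c0b] := shift_onto b c0; exists u; rewrite -c0b Rc0 andbT lt0n.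
  by apply: contraNneq nR => u0; move: c0b; rewrite u0 /= => <-.
case: (ex_minnP ex) => m /andP[m_gt0 Rm] minm.
exists (shift b m); apply/maxS/add_zV => //; first exact: RL.
move=> c w Rc w0 rE _; case: (leqP w m) => [wm|mw].
  have cE : c = shift b (m - w) by apply: (@shift_inj n w); rewrite -rE shiftD subnK.
  case: (posnP (m - w)) => mw0; first by rewrite cE mw0 (negPf nR) in Rc.
  by have := minm (m - w); rewrite mw0 -cE Rc => /(_ isT); lia.
have bE : b = shift c (w - m) by apply: (@shift_inj n m); rewrite rE shiftD subnK // ltnW.
by exists (w - m); rewrite -bE; split=> //; lia.
Qed.

Section MaximalGap.
Variables (S : {set cvar n}) (a : 'I_n) (len : nat).
Hypotheses (maxS : maximal_reduced S) (aS : gap S a len).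

Let red := proj1 maxS.
Let R u := yR (shift a u) \in S.
Let L u := yL (shift a u) \in S.
Let Z u := zE (shift a u) \in S.
Let t u := tE (shift a u) \in S.

Lemma first_not_L : yL a \notin S.
Proof. exact: reduced_zL red _ (gap_start aS). Qed.

(** If adding the inner vertex r kept S reduced, maximality would put it in S. *)
Lemma no_split (r : nat) : 0 < r < len -> yL (shift a r) \notin S ->
    (forall p, p < r -> R p -> exists j, [/\ p < j < r, ~~ R j & ~~ Z j]) ->
  False.
Proof.
move=> rlen nL H; have /negP[] := gap_inside aS rlen.
apply/(proj2 maxS)/add_zV => // c u Rc u0 rE noz.
have noz' v : 0 < v <= u -> zV (shift c v) \notin S.
  case/andP=> v0; rewrite leq_eqVlt => /orP[/eqP->|vu]; last by apply: noz; rewrite v0.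
  by rewrite -rE; apply: (gap_inside aS).
have [ur cE] := gap_position (gap_start aS) rE noz'.
have [||j [jr nR nZ]] := H (r - u); [lia|by rewrite /R -cE|].
have jE : shift c (j - (r - u)) = shift a j by rewrite cE shiftD; congr shift; lia.
by exists (j - (r - u)); rewrite jE; split=> //; lia.
Qed.

Lemma t_excludes j : t j -> [/\ ~~ R j, ~~ L j & ~~ Z j].
Proof.
rewrite /t => tj; split.
- by apply: contraL tj; apply: (reduced_Rt red).
- by apply: contraL tj; apply: (reduced_Lt red).
- by apply: contraL tj; apply: (reduced_Zt red).
Qed.

(** Otherwise a vertex could be added at the first yR after the t, since the t
    stops all the runs coming from before. *)
Lemma no_R_after_t j u : t j -> j < u < len -> ~~ R u.
Proof.
move=> tj /andP[ju ul]; apply/negP=> Ru; have [nR nL nZ] := t_excludes tj.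
have ex : exists v, (j < v) && R v by exists u; rewrite ju.
case: (ex_minnP ex) => v /andP[jv Rv] minv.
have vu := minv u; rewrite ju Ru in vu; have {}vu := vu isT.
apply: (@no_split v); [by lia|exact: (reduced_RL red)|].
move=> p pv Rp; case: (ltngtP p j) => [pj|jp|pj]; last by rewrite -pj Rp in nR.
  by exists j; split=> //; lia.
by have := minv p; rewrite jp Rp => /(_ isT); lia.
Qed.

(** Otherwise a vertex could be added at the second t. *)
Lemma no_t_after_t j u : t j -> j < u < len -> ~~ t u.
Proof.
move=> tj jul; apply/negP=> tu; have [nR _ nZ] := t_excludes tj.
have [_ nL _] := t_excludes tu.
apply: (@no_split u) => //; first by lia.
move=> p pu Rp; case: (ltngtP p j) => [pj|jp|pj]; last by rewrite -pj Rp in nR.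
  by exists j; split=> //; lia.
by have := @no_R_after_t j p tj; rewrite Rp jp => /(_ _)/negP[] //; lia.
Qed.

Lemma L_maximal u : 0 < u < len -> ~~ R u -> ~~ t u -> L u.
Proof.
move=> ulen nR nt; apply/(proj2 maxS)/add_yL => //; first exact: (gap_inside aS).
exists a; first exact: first_not_L.
by apply/eqP=> e; apply: (gap_neq aS ulen).
Qed.

(** A run that stops at an edge u of the interval without meeting a vertex must
    have started in the same interval. *)
Lemma reroute_in_gap u : u < len ->
    (forall p, p < u -> R p -> exists j, [/\ p < j < len, j != u, ~~ R j & ~~ Z j]) ->
  reroute S (shift a u).
Proof.
move=> ul H c Rc; have [m [m0 noz nR nZ]] := reduced_R red Rc.
case: (eqVneq (shift c m) (shift a u)) => [e|ne]; last by exists m.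
have [mu cE] := gap_position (gap_start aS) (esym e) noz.
have [||j [jlen ju jR jZ]] := H (u - m); [lia|by rewrite /R -cE|].
have sE v : shift c v = shift a (u - m + v) by rewrite cE shiftD.
have jE : shift c (j - (u - m)) = shift a j by rewrite sE subnKC //; lia.
exists (j - (u - m)); rewrite /stops jE.
  split=> //; first by lia.
  by move=> v vj; rewrite sE; apply: (gap_inside aS); lia.
apply/eqP=> e'; case: (ltngtP j u) ju => // lt _.
  by apply: (gap_neq aS _ e'); rewrite lt.
  by apply: (gap_neq aS _ (esym e')); rewrite lt; case/andP: jlen.
Qed.

Lemma Z_maximal u : u < len -> ~~ t u ->
    (forall p, p < u -> R p -> exists j, [/\ p < j < len, j != u, ~~ R j & ~~ Z j]) ->
  Z u.
Proof. by move=> ul nt H; apply/(proj2 maxS)/add_zE => //; apply: reroute_in_gap. Qed.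

(** To the left of an edge that stops all runs, zE is harmless, and so is yR on an
    edge without yL. *)
Lemma before_block j u : u < j < len -> ~~ R j -> ~~ Z j -> ~~ t u ->
  edge_left S (shift a u) \/ edge_right S (shift a u).
Proof.
move=> /andP[uj jl] nR nZ nt; have ul := ltn_trans uj jl.
have rr p : p < u -> R p -> exists j, [/\ p < j < len, j != u, ~~ R j & ~~ Z j].
  by move=> pu _; exists j; split=> //; lia.
have Zu : Z u by apply: Z_maximal.
have [Lu|nL] := boolP (L u).
  left; split=> //; last exact: negbTE.
  by apply: contraTF Lu; apply: (reduced_RL red).
right; split=> //; try exact: negbTE.
apply/(proj2 maxS)/add_yR => //; first exact: reroute_in_gap.
exists (j - u); rewrite ?shiftD ?subnKC ?(ltnW uj) //.
  split; rewrite ?subn_gt0 // ?shiftD ?subnKC ?(ltnW uj) // => v vj.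
  by rewrite shiftD; apply: (gap_inside aS); lia.
by apply/eqP=> e; apply: (gap_neq aS _ (esym e)); rewrite uj.
Qed.

Lemma no_R_before_Zs u : u < len -> (forall v, u < v < len -> Z v) -> ~~ R u.
Proof.
move=> ul Zs; apply/negP=> /(reduced_R red)[m [m0 noz _ nZ]].
have sE v : shift (shift a u) v = shift a (u + v) by rewrite shiftD.
case: (ltnP (u + m) len) => uml.
  by move: nZ; rewrite sE; apply/negP; rewrite negbK; apply: Zs; lia.
have := noz (len - u); rewrite sE subnKC ?(gap_end aS) ?(ltnW ul) //.
by move=> /(_ _)/negP[] //; lia.
Qed.

Lemma right_at_start j : 0 < j < len -> ~~ R j -> ~~ Z j -> ~~ t 0 -> edge_right S a.
Proof.
move=> jl nR nZ nt; case: (@before_block j 0) => // -[_ L0].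
by move: first_not_L; rewrite L0.
Qed.

Lemma turning_of_block j : 0 < j < len ->
    edge_type S (shift a j) false false false true \/
      edge_type S (shift a j) false true false false ->
    (forall u, j < u < len -> edge_left S (shift a u)) ->
    (forall u, u < j -> ~~ t u) ->
  turning_gap S a len j.
Proof.
move=> jlen tj after nt.
have [nR nZ] : ~~ R j /\ ~~ Z j by rewrite /R /Z; case: tj => -[-> _ -> _].
split=> //; first by apply: (right_at_start jlen) => //; apply: nt; lia.
by move=> u ulen; apply: (@before_block j) => //; [lia|apply: nt; lia].
Qed.

(** The turning edge is the edge with t if there is one; otherwise it is the last
    edge without zE, which must then carry yL.  If all edges carry zE, a yR
    would run into the right end of the interval. *)
Lemma maximal_gap : (exists s, turning_gap S a len s) \/ left_gap S a len.
Proof.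
have Lleft u : 0 < u < len -> ~~ R u -> ~~ t u -> Z u -> edge_left S (shift a u).
  move=> ulen nR nt Zu; split=> //; try exact: negbTE.
  exact: L_maximal.
have [/existsP[[j jl] /= tj]|/existsPn nt'] := boolP [exists j : 'I_len, t j].
  have [nR nL nZ] := t_excludes tj.
  have tty : edge_type S (shift a j) false false false true.
    by split=> //; exact: negbTE.
  have after u : j < u < len -> edge_left S (shift a u).
    move=> jul; have nRu := no_R_after_t tj jul; have ntu := no_t_after_t tj jul.
    apply: Lleft => //; first by lia.
    apply: Z_maximal => //; first by lia.
    move=> p pu Rp; exists j; split=> //; last by lia.
    rewrite jl andbT ltnNge leq_eqVlt; apply/negP=> /orP[/eqP e|jp].
      by rewrite e Rp in nR.
    by have := @no_R_after_t j p tj; rewrite Rp jp => /(_ _)/negP[] //; lia.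
  have before u : u < j -> ~~ t u.
    by move=> uj; apply: contraL tj => tu; apply: (no_t_after_t tu); rewrite uj.
  case: (posnP j) => j0; last by left; exists j; apply: turning_of_block; rewrite ?j0 //; left.
  by right; subst j; split; [right|].
have nt u : u < len -> ~~ t u by move=> ul; apply: (nt' (Ordinal ul)).
have [/existsP[[j1 jl1] /= nZ1]|/existsPn allZ] := boolP [exists j : 'I_len, ~~ Z j]; last first.
  have {}allZ u : u < len -> Z u by move=> ul; have := allZ (Ordinal ul); rewrite negbK.
  have nR u : u < len -> ~~ R u.
    by move=> ul; apply: no_R_before_Zs => // v /andP[_ vl]; apply: allZ.
  right; split=> [|u /andP[u0 ul]]; last by apply: Lleft; rewrite ?u0 ?nR ?nt ?allZ.
  have len0 := gap_gt0 aS; left; split; try exact: negbTE (first_not_L).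
  - exact: negbTE (nR 0 len0).
  - exact: (allZ 0 len0).
  - exact: negbTE (nt 0 len0).
have ex : exists j, (j < len) && ~~ Z j by exists j1; rewrite jl1.
have bound j : (j < len) && ~~ Z j -> j <= len by case/andP=> /ltnW.
case: (ex_maxnP ex bound) => j /andP[jl nZ] maxj.
have Zafter u : j < u < len -> Z u.
  move=> /andP[ju ul]; apply: contraT => nZu.
  by have := maxj u; rewrite ul nZu => /(_ isT); lia.
have nRj u : j <= u -> u < len -> ~~ R u.
  by move=> ju ul; apply: no_R_before_Zs => // v uv; apply: Zafter; lia.
have j0 : 0 < j.
  rewrite lt0n; apply: contraNneq nZ => j0; rewrite j0 in jl *.
  by apply: Z_maximal => //; apply: nt.
left; exists j; apply: turning_of_block; rewrite ?j0 ?jl //.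
- right; split; try exact: negbTE.
  + exact: negbTE (nRj j (leqnn j) jl).
  + by apply: L_maximal; rewrite ?j0 ?jl ?nRj ?nt.
  + exact: negbTE (nt j jl).
- move=> u jul; have /andP[ju ul] := jul.
  by apply: Lleft; rewrite ?nRj ?nt ?Zafter ?(ltnW ju) //; lia.
by move=> u uj; apply: nt; apply: ltn_trans jl.
Qed.
End MaximalGap.

Lemma maximal_complete S : maximal_reduced S -> complete S.
Proof.
move=> maxS; split; first exact: maximal_has_vertex.
move=> a za; have [len aS] := gap_exists za; exists len.
by apply/admissibleP; split=> //; apply: maximal_gap.
Qed.

Lemma reduced_sub_maximal S : reduced S -> exists2 M, maximal_reduced M & S \subset M.
Proof.
have [k] := ubnP #|~: S|; elim: k S => // k IHk S; rewrite ltnS => Sk red.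
have [[v [redv vS]]|none] := classic (exists v, reduced (v |: S) /\ v \notin S).
  have [||M maxM vSM] := IHk (v |: S) => //; last first.
    by exists M => //; apply: subset_trans vSM; apply: subsetUr.
  apply: leq_trans Sk; apply: proper_card; rewrite properE setCS subsetUr /=.
  by rewrite setCS; apply: contra vS => /subsetP; apply; exact: setU11.
exists S => //; split=> // v redv; apply: contraT => vS.
by case: none; exists v.
Qed.

(** Both sides speak of the same intervals: the numbers i t - i s and
    i first + n - i last are the distances from a vertex of S to the next one. *)
Lemma complete_enumP S k (i : 'I_k -> 'I_n) :
    (forall s t : 'I_k, s < t -> i s < i t) ->
    Zset S = [set i t | t : 'I_k] ->
  complete S <->
  [/\ Zset S <> set0,
      forall s t : 'I_k, t = s.+1 :> nat ->
        admissible S (i s) (i t - i s)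
    & forall first last : 'I_k, first = 0 :> nat -> last = k.-1 :> nat ->
        admissible S (i last) (i first + n - i last)].
Proof.
move=> incr enumE.
have zi t : zV (i t) \in S.
  by have : i t \in Zset S; [rewrite enumE imset_f|rewrite inE].
have zP e : zV e \in S -> exists t, e = i t.
  move=> ze; have : e \in Zset S by rewrite inE.
  by rewrite enumE => /imsetP[t _ ->]; exists t.
have mono s t : i s < i t -> s < t.
  case: (ltngtP s t) => // [/incr|/val_inj->]; lia.
split=> [[[z zS] adm]|[Z0 consec wrap]].
  have admE a d : gap S a d -> admissible S a d.
    move=> ad; have [d' al] := adm a (gap_start ad).
    by have /admissibleP[/(gap_uniq ad)->] := al.
  split.
  - by move/setP/(_ z); rewrite !inE zS.
  - move=> s t ts; have st : i s < i t by apply: incr; rewrite ts.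
    have tE : shift (i s) (i t - i s) = i t.
      by apply: val_inj; rewrite /= val_shift subnKC ?(ltnW st) // modn_small.
    apply: admE; split; rewrite ?tE //; first by rewrite subn_gt0.
    move=> u ud; apply/negP=> /zP[w wE].
    have := congr1 val wE; rewrite /= val_shift modn_small; last by have := ltn_ord (i t); lia.
    by move=> e; have := @mono s w; have := @mono w t; lia.
  move=> f l f0 lk; have fl : i f <= i l.
    by case: (ltngtP f l) => [/incr/ltnW //||/val_inj->//]; rewrite f0.
  have ifn := ltn_ord (i f); have iln := ltn_ord (i l).
  have fE : shift (i l) (i f + n - i l) = i f.
    apply: val_inj; rewrite /= val_shift subnKC; last by lia.
    by rewrite modnDr modn_small.
  apply: admE; split; rewrite ?fE //; first by lia.
  move=> u ud; apply/negP=> /zP[w wE].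
  have := congr1 val wE; rewrite /= val_shift => e.
  have wl : i w <= i l.
    rewrite leqNgt; apply/negP=> /mono; rewrite lk; have := ltn_ord w; lia.
  have fw : i f <= i w by rewrite leqNgt; apply/negP=> /mono; rewrite f0.
  case: (ltnP (i l + u) n) => lun; first by rewrite modn_small in e; lia.
  move: e; rewrite -(subnK lun) modnDr modn_small; lia.
have [z zS] : exists z, zV z \in S.
  apply: NNPP => none; apply: Z0; apply/setP=> z; rewrite !inE.
  by apply/negP=> zS; apply: none; exists z.
split; first by exists z.
move=> _ /zP[t ->]; have kt := ltn_ord t.
have [tk|tk] := ltnP t.+1 k.
  by exists (i (Ordinal tk) - i t); apply: consec.
have k0 : 0 < k by lia.
by exists (i (Ordinal k0) + n - i t); apply: wrap => //; lia.
Qed.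
End Maximal.

(** * Facets *)

Lemma facet_complete (K : fieldType) (n : nat) (S : {set cvar n}) : (0 < n)%N ->
  is_facet K S <-> complete S.
Proof.
move=> n0; split=> [[face maxS]|comp].
  have [M maxM SM] := reduced_sub_maximal (face_reduced n0 face).
  have compM := maximal_complete maxM.
  by rewrite -(maxS M (complete_face compM) SM).
split=> [|S' face' SS']; first exact: complete_face.
exact: complete_antichain comp SS' (face_reduced n0 face').
Qed.

Theorem theorem4p1 (K : fieldType) (n : nat) (hn : (3 <= n)%N)
    (S : {set cvar n}) (k : nat) (i : 'I_k -> 'I_n)
    (i_incr : forall s t : 'I_k, (s < t)%N -> (i s < i t)%N)
    (i_enum : Zset S = [set i t | t : 'I_k]) :
  is_facet K S <->
  [/\ Zset S <> set0,
      forall s t : 'I_k, t = s.+1 :> nat ->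
        admissible S (i s) (i t - i s)
    & forall first last : 'I_k, first = 0%N :> nat -> last = k.-1 :> nat ->
        admissible S (i last) (i first + n - i last)].
Proof.
rewrite facet_complete; last by apply: leq_trans hn.
exact: complete_enumP.
Qed.
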